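(* Let $G=A\ast B$ be the free product of residually finite groups $A$ and $B$. Let $u_1,\ldots,u_n\in G$ be elements such that: (i) for every $i$, $u_i\notin \bigcup_{g\in G}\big(g^{-1}Ag\cup g^{-1}Bg\big)$, i.e. no $u_i$ lies in a conjugate of a free factor; (ii) for all $i\neq j$, the elements $u_i$ and $u_j$ do not belong to conjugate cyclic subgroups, i.e. there are no $c,g\in G$ with $u_i\in\langle c\rangle$ and $u_j\in g^{-1}\langle c\rangle g$. Then there exists a natural number $K$ such that for every ordered sequence $l_1,\ldots,l_n$ of natural numbers there exists a homomorphism $\varphi$ of $G$ onto a finite group such that the order of $\varphi(u_i)$ equals $Kl_i$ for every $i=1,\ldots,n$. *)

(* Defs.v *)
From HB Require Import structures.
From mathcomp Require Import all_boot all_order all_fingroup.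
Set Implicit Arguments. Unset Strict Implicit. Unset Printing Implicit Defensive.

Record agroup := AGroup {
  gcar :> Type;
  gmul : gcar -> gcar -> gcar;
  gone : gcar;
  ginv : gcar -> gcar;
  gmulA : forall x y z, gmul x (gmul y z) = gmul (gmul x y) z;
  gmul1 : forall x, gmul gone x = x;
  gmulV : forall x, gmul (ginv x) x = gone
}.
Arguments gmul {a}. Arguments gone {a}. Arguments ginv {a}.

Definition is_hom (G H : agroup) (f : G -> H) : Prop :=
  forall x y, f (gmul x y) = gmul (f x) (f y).

Definition is_fhom (G : agroup) (gT : finGroupType) (f : G -> gT) : Prop :=
  forall x y, f (gmul x y) = (f x * f y)%g.

Fixpoint gpow (G : agroup) (x : G) (k : nat) : G :=
  match k with 0 => gone | k'.+1 => gmul x (gpow x k') end.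

Definition gconj (G : agroup) (g x : G) : G := gmul (ginv g) (gmul x g).

Definition in_cyclic (G : agroup) (c u : G) : Prop :=
  exists k : nat, u = gpow c k \/ u = gpow (ginv c) k.

Definition is_free_product (A B G : agroup) (iA : A -> G) (iB : B -> G) : Prop :=
  is_hom iA /\ is_hom iB /\
  forall (H : agroup) (fA : A -> H) (fB : B -> H), is_hom fA -> is_hom fB ->
    exists! h : G -> H, is_hom h /\ (forall a, h (iA a) = fA a)
                                  /\ (forall b, h (iB b) = fB b).

Definition residually_finite (A : agroup) : Prop :=
  forall a : A, a <> gone ->
    exists (gT : finGroupType) (f : A -> gT), is_fhom f /\ f a <> 1%g.

(* Main.v *)
Require Import Defs.
From HB Require Import structures.
From mathcomp Require Import all_boot all_order all_fingroup.
From mathcomp Require Import all_algebra all_solvable.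
From mathcomp Require Import zify.
From mathcomp Require Import boolp.
Set Implicit Arguments. Unset Strict Implicit. Unset Printing Implicit Defensive.
Import GroupScope.

(** Up to conjugation every [u_i] is a cyclic word [a_1 b_1 ... a_k b_k] with
    nontrivial letters, and by residual finiteness the letters may be taken in
    finite quotients of [A] and [B]. It suffices to fix [u] among the [u_i] and
    to find [M] such that for all [l] some finite quotient gives [u] the order
    [M l] and all other [v] an order dividing [M]: a product of such quotients
    then settles all the [u_i] at once.

    There is a finite quotient [Q] whose Cayley graph sees each word as a cycle
    running at most once through each coset of the factors. Then the integral
    chain of a [v]-cycle is nonzero and differs from plus or minus the chain of
    a [u]-cycle [C], for otherwise the periodic words of [u] and [v] would
    agree up to shift and inversion, and [u], [v] would lie in conjugate cyclic
    subgroups. Hence some integral weight on [Q] vanishes on [C] but on no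
    [v]-cycle; reduced modulo a large prime [p], it defines a [p]-fold cover
    [Q x F_p] in which the [v]-cycles are invariant under the translations of
    [F_p], while [C] lifts to a closed cycle. The weight +1 at [(1, 0)] and
    -1 at [(1, 1)] thus vanishes on all [v]-cycles but not on the lift of [C],
    and twisting once more by this weight, with values in [Z/L], multiplies the
    order of [u] at will without changing those of the [v]. *)

(** * Periodic words and a quotient in which they trace simple cycles *)

Lemma morph1_of (R R' : finGroupType) (h : R -> R')
  (hM : {morph h : u v / u * v}) : h 1 = 1.
Proof. by apply: (mulgI (h 1)); rewrite -hM !mulg1. Qed.

Lemma morphV_of (R R' : finGroupType) (h : R -> R')
  (hM : {morph h : u v / u * v}) x : h x^-1 = (h x)^-1.
Proof. by apply: (mulgI (h x)); rewrite -hM !mulgV morph1_of. Qed.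

Section Periodic.
Variables (C : Type) (z : nat -> C) (k : nat).
Hypothesis pz : forall i, z (k + i) = z i.

Lemma period_mulD c i : z (k * c + i) = z i.
Proof. by elim: c => [|c IH]; rewrite ?muln0 // mulnS -addnA pz. Qed.

Lemma period_mod n m : n = m %[mod k] -> z n = z m.
Proof.
have zm l : z l = z (l %% k) by rewrite {1}(divn_eq l k) mulnC period_mulD.
by move=> e; rewrite (zm n) e -zm.
Qed.

End Periodic.

Section Path.
Variables (R : finGroupType) (x y : nat -> R).

(** The word [x 0 y 0 x 1 y 1 ...] read from the identity: [ev m] is the prefix of [2m] letters,
    [od m] that of [2m + 1] letters. *)
Fixpoint ev (m : nat) : R :=
  match m with 0 => 1 | m'.+1 => ev m' * x m' * y m' end.
Definition od (m : nat) : R := ev m * x m.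

Lemma evS m : ev m.+1 = od m * y m. Proof. by []. Qed.

Variable k : nat.
Hypotheses (px : forall i, x (k + i) = x i) (py : forall i, y (k + i) = y i).

Lemma ev_period m : ev (k + m) = ev k * ev m.
Proof.
elim: m => [|m IH]; first by rewrite addn0 mulg1.
by rewrite addnS /= IH px py !mulgA.
Qed.

Lemma ev_mul c : ev (k * c) = ev k ^+ c.
Proof.
elim: c => [|c IH]; first by rewrite muln0.
by rewrite mulnS ev_period IH expgS.
Qed.

Lemma ev_mulD c m : ev (k * c + m) = ev k ^+ c * ev m.
Proof.
elim: c => [|c IH]; first by rewrite muln0 mul1g.
by rewrite mulnS -addnA ev_period IH expgS mulgA.
Qed.

Lemma od_mulD c m : od (k * c + m) = ev k ^+ c * od m.
Proof. by rewrite /od ev_mulD period_mulD // mulgA. Qed.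

End Path.

Lemma ev_morph (R R' : finGroupType) (h : R -> R')
    (hM : {morph h : u v / u * v}) (x y : nat -> R) m :
  h (ev x y m) = ev (h \o x) (h \o y) m.
Proof.
elim: m => [|m IH] /=; last by rewrite !hM IH.
exact: morph1_of.
Qed.

Lemma od_morph (R R' : finGroupType) (h : R -> R')
    (hM : {morph h : u v / u * v}) (x y : nat -> R) m :
  h (od x y m) = od (h \o x) (h \o y) m.
Proof. by rewrite /od hM ev_morph. Qed.

Lemma eq_ev (R : finGroupType) (x y x' y' : nat -> R) m :
  x =1 x' -> y =1 y' -> ev x y m = ev x' y' m.
Proof. by move=> ex ey; elim: m => //= m ->; rewrite ex ey. Qed.

(** * A permutation quotient built from glued regular orbits *)

Section Glue.
Variables (A B : finGroupType) (J : finType) (K : nat).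
Hypothesis K0 : 0 < K.
Variables (a : J -> nat -> A) (b : J -> nat -> B).
Hypotheses (a1 : forall j i, a j i != 1) (b1 : forall j i, b j i != 1).
Hypotheses (pa : forall j i, a j (K + i) = a j i)
           (pb : forall j i, b j (K + i) = b j i).

Let X := ((J * 'I_K) * (A + B))%type.

(* The gluing involution: the A-edge [inl (a j i)] is identified with the
   B-edge [inr 1] over [i], and [inr (b j i)] with [inl 1] over [i + 1]. *)
Definition glue (z : X) : X :=
  let: ((j, i), e) := z in
  match e with
  | inl c => if c == 1 then ((j, ord_pred i), inr (b j (ord_pred i)))
             else if c == a j i then ((j, i), inr 1) else z
  | inr c => if c == 1 then ((j, i), inl (a j i))
             else if c == b j i then ((j, ordS i), inl 1) else z
  end.

Lemma glueK : involutive glue.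
Proof.
move=> [[j i] [c|c]] /=.
  case: (eqVneq c 1) => [->|nc] /=.
    by rewrite (negPf (b1 _ _)) eqxx ord_predK.
  case: (eqVneq c (a j i)) => [->|nca] /=; first by rewrite eqxx.
  by rewrite (negPf nc) (negPf nca).
case: (eqVneq c 1) => [->|nc] /=.
  by rewrite (negPf (a1 _ _)) eqxx.
case: (eqVneq c (b j i)) => [->|nca] /=.
  by rewrite eqxx ordSK; congr (_, inr (b j _)); apply: (congr1 val (ordSK i)).
by rewrite (negPf nc) (negPf nca).
Qed.

Definition actA (c : A) (z : X) : X :=
  match z.2 with inl d => (z.1, inl (d * c)) | inr _ => z end.
Definition actB (c : B) (z : X) : X :=
  match z.2 with inr d => (z.1, inr (d * c)) | inl _ => z end.

Lemma actA_inj c : injective (actA c).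
Proof.
move=> [i [d|d]] [i' [d'|d']] //.
by rewrite /actA /= => -[-> /mulIg ->].
Qed.
Lemma actB_inj c : injective (actB c).
Proof.
move=> [i [d|d]] [i' [d'|d']] //.
by rewrite /actB /= => -[-> /mulIg ->].
Qed.

Let gp : {perm X} := perm (inv_inj glueK).
Definition permA c : {perm X} := perm (@actA_inj c).
(** Conjugation by the gluing keeps the action multiplicative and places the regular [B]-orbit over
    [i] so that [b j i] leads from [inl (a j i)] over [i] to [inl 1] over [i + 1]. *)
Definition permB c : {perm X} := perm (@actB_inj c) ^ gp.

Lemma permA_morph : {morph permA : c d / c * d}.
Proof.
move=> c d; apply/permP => -[i [e|e]]; rewrite permM !permE //=.
by rewrite /actA /= mulgA.
Qed.

Lemma permB_morph : {morph permB : c d / c * d}.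
Proof.
move=> c d; rewrite -conjMg; congr (_ ^ _).
apply/permP => -[i [e|e]]; rewrite permM !permE //=.
by rewrite /actB /= mulgA.
Qed.

Lemma permBE c z : permB c z = glue (actB c (glue z)).
Proof.
have gpV : gp^-1 z = glue z.
  have gpE : gp (glue z) = z by rewrite permE glueK.
  by rewrite -{1}gpE permK.
by rewrite /permB /conjg !permM gpV !permE.
Qed.

Let o (m : nat) : 'I_K := Ordinal (ltn_pmod m K0).
Let E j := ev (fun i => permA (a j i)) (fun i => permB (b j i)).
Let O j := od (fun i => permA (a j i)) (fun i => permB (b j i)).

Lemma pa_mod j m : a j (m %% K) = a j m.
Proof. by apply: (period_mod (pa j)); rewrite modn_mod. Qed.
Lemma pb_mod j m : b j (m %% K) = b j m.
Proof. by apply: (period_mod (pb j)); rewrite modn_mod. Qed.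

Lemma evX j m : E j m ((j, o 0), inl 1) = ((j, o m), inl 1).
Proof.
elim: m => [|m IH]; first by rewrite perm1.
have IHo : O j m ((j, o 0), inl 1) = ((j, o m), inl (a j m)).
  by rewrite /O /od permM IH permE /actA /= mul1g.
rewrite /E evS permM -/(O j) IHo permBE /= (negPf (a1 _ _)).
rewrite pa_mod eqxx /actB /= mul1g (negPf (b1 _ _)) pb_mod eqxx.
by congr ((_, _), _); apply: val_inj; rewrite /= -addn1 modnDml addn1.
Qed.

Lemma odX j m : O j m ((j, o 0), inl 1) = ((j, o m), inl (a j m)).
Proof. by rewrite /O /od permM evX permE /actA /= mul1g. Qed.

(** Applied to the base point, the left side lands on [inl 1] over [n'] and the right side on
    [inl c] over [n]. *)
Lemma simpleA j n n' c : E j n' = E j n * permA c -> n = n' %[mod K] /\ c = 1.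
Proof.
move/(congr1 (fun s : {perm X} => s ((j, o 0), inl 1))).
rewrite (permM (E j n)) !evX permE /actA /= mul1g => -[/esym -> <-].
by [].
Qed.

Lemma simpleB j n n' c : O j n' = O j n * permB c -> n = n' %[mod K] /\ c = 1.
Proof.
(* A final [glue] moves both end points into [inr] blocks, where the factor [c] can be read off. *)
move/(congr1 (fun s : {perm X} => glue (s ((j, o 0), inl 1)))).
rewrite (permM (O j n)) !odX permBE glueK /= !(negPf (a1 _ _)) !pa_mod !eqxx.
by rewrite /actB /= mul1g => -[/esym -> <-].
Qed.

End Glue.

(** * Separating weights and twisted permutations *)

Section Weight.
Local Open Scope ring_scope.
Import GRing.Theory Num.Theory Order.TTheory.

(** The lowest digit is divisible by 5 and at most 2 in size, so it vanishes; dividing by 5 leaves a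
    shorter expansion. *)
Lemma base5_eq0 N (d : 'I_N -> int) : (forall i, `|d i| <= 2%:Z) ->
  \sum_(i < N) d i * 5%:Z ^+ i = 0 -> forall i, d i = 0.
Proof.
elim: N d => [|N IH] d dle; first by move=> _ [].
rewrite big_ord_recl expr0 mulr1 /=.
under eq_bigr do rewrite exprS mulrCA.
rewrite -mulr_sumr; set S := \sum_(i < N) _ => e.
have d0 : d ord0 = 0 by have := dle ord0; lia.
have /IH z : S = 0 by lia.
by move=> i; case: (unliftP ord0 i) => [k|] -> //; apply: z => k'; apply: dle.
Qed.

Definition sgn3 (T : Type) (D : T -> int) :=
  forall x, [\/ D x = 0, D x = 1 | D x = -1].

(* The weight is a base 5 expansion, corrected at [e] so that [C] has weight 0:
   then [D] has weight [\sum_x (D x - D e * C x) * 5 ^ rank x]. *)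
Lemma separating_weight (T : finType) (C : T -> int) (e : T) :
  sgn3 C -> C e = 1 ->
  exists psi : T -> int, \sum_x C x * psi x = 0 /\
    forall D, sgn3 D -> (exists x, D x != 0) -> (exists x, D x != C x) ->
      (exists x, D x != - C x) -> \sum_x D x * psi x != 0.
Proof.
move=> sC Ce; pose w (x : T) := 5%:Z ^+ enum_rank x.
pose psi x := w x - (x == e)%:R * \sum_y C y * w y.
have psiE D : \sum_x D x * psi x = \sum_x (D x - D e * C x) * w x.
  under eq_bigr do rewrite mulrBr; under [RHS]eq_bigr do rewrite mulrBl.
  rewrite !sumrB; congr (_ - _).
  rewrite (bigD1 e) //= eqxx mul1r [X in _ + X]big1; last by move=> x /negPf->; rewrite mul0r mulr0.
  by rewrite addr0 mulr_sumr; apply: eq_bigr => x _; rewrite mulrA.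
exists psi; split.
  by rewrite psiE big1 // => x _; rewrite Ce mul1r subrr mul0r.
move=> D sD [x0 D0] [x1 D1] [x2 D2]; rewrite psiE; apply/eqP => e0.
(* A difference of two values among 0, 1, -1 is an admissible base 5 digit, so all digits vanish. As
   [D e] is 0, 1 or -1, [D] would then be 0, [C] or [- C]. *)
have {e0} H x : D x = D e * C x.
  suff : D x - D e * C x = 0 by lia.
  pose d (i : 'I_#|T|) := D (enum_val i) - D e * C (enum_val i).
  have -> : D x - D e * C x = d (enum_rank x) by rewrite /d enum_rankK.
  apply: base5_eq0 => [i|]; last first.
    rewrite -[RHS]e0 (reindex (@enum_val T predT)) /=; last first.
      by exists enum_rank => y _; [apply: enum_valK|apply: enum_rankK].
    by apply: eq_bigr => i _; rewrite /w enum_valK.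
  rewrite /d; case: (sC (enum_val i)) => ->; case: (sD (enum_val i)) => ->;
    by case: (sD e) => ->.
case: (sD e) => De.
- by move: D0; rewrite H De mul0r eqxx.
- by move: D1; rewrite H De mul1r eqxx.
- by move: D2; rewrite H De mulN1r eqxx.
Qed.

End Weight.

(** * Skew products over a permutation action *)

Section Twist.
Import GRing.Theory.
Variables (X : finType) (M : finZmodType).

Definition lift_fun (s : {perm X}) (z : X * M) : X * M := (s z.1, z.2).
Lemma lift_fun_inj s : injective (lift_fun s).
Proof. by move=> [x y] [x' y'] [/perm_inj -> ->]. Qed.
Definition liftp s : {perm X * M} := perm (@lift_fun_inj s).

Variable t : X -> M.
Definition shift_fun (z : X * M) : X * M := (z.1, z.2 + t z.1)%R.
Lemma shift_fun_inj : injective shift_fun.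
Proof. by move=> [x y] [x' y'] [-> /addIr ->]. Qed.
Definition shiftp : {perm X * M} := perm shift_fun_inj.
(** A change by a coboundary, so still an action. As the other factor keeps the untwisted [liftp], a
    closed alternating word can still have nonzero total [drift]. *)
Definition twistp s := liftp s ^ shiftp.

Lemma liftp_morph : {morph liftp : r s / r * s}.
Proof.
by move=> r s; apply/permP => -[x y]; rewrite permM !permE /lift_fun /= permM.
Qed.
Lemma twistp_morph : {morph twistp : r s / r * s}.
Proof. by move=> r s; rewrite /twistp liftp_morph conjMg. Qed.

Lemma liftpE s x y : liftp s (x, y) = (s x, y).
Proof. by rewrite permE. Qed.
Lemma twistpE s x y : twistp s (x, y) = (s x, y + (t (s x) - t x))%R.
Proof.
have e : shiftp^-1 (x, y) = (x, y - t x)%R.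
  have E : shiftp (x, y - t x)%R = (x, y) by rewrite permE /shift_fun /= subrK.
  by rewrite -{1}E permK.
rewrite /twistp /conjg permM e permM liftpE permE /shift_fun /=.
by congr (_, _); rewrite addrAC -addrA.
Qed.

Variables (x y : nat -> {perm X}).
Definition drift m z : M := (\sum_(i < m) (t (ev x y i.+1 z) - t (od x y i z)))%R.

Lemma ev_twist m z r :
  ev (liftp \o x) (twistp \o y) m (z, r) = (ev x y m z, r + drift m z)%R.
Proof.
elim: m => [|m IH]; first by rewrite !perm1 /drift big_ord0 addr0.
have e : od (liftp \o x) (twistp \o y) m (z, r) =
    (od x y m z, r + drift m z)%R by rewrite /od permM IH liftpE permM.
rewrite evS permM e twistpE -permM -evS /drift.
by rewrite [in RHS]big_ord_recr -addrA.
Qed.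

Lemma iter_twist (w : {perm X * M}) (s : {perm X}) (S : X -> M) :
  (forall z r, w (z, r) = (s z, r + S z)%R) ->
  forall c z r, (w ^+ c) (z, r) = ((s ^+ c)%g z, r + \sum_(i < c) S ((s ^+ i)%g z))%R.
Proof.
move=> H; elim=> [|c IH] z r; first by rewrite !perm1 big_ord0 addr0.
by rewrite !expgSr !permM IH H big_ord_recr /= addrA.
Qed.

End Twist.

Section RightMult.
Variable Q : finGroupType.
Definition rmul (q : Q) : {perm Q} := perm (mulIg q).
Lemma rmul_morph : {morph rmul : q r / q * r}.
Proof. by move=> q r; apply/permP => z; rewrite permM !permE mulgA. Qed.
Lemma rmulE q z : rmul q z = z * q. Proof. by rewrite permE. Qed.
End RightMult.

(** * Cycles of words in a finite quotient *)

Arguments ev : simpl never.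

Section Sums.
Local Open Scope ring_scope.
Import GRing.Theory.

Lemma sum_Fp_translate p (pr_p : prime p) (h r : 'F_p) (F : 'F_p -> int) :
  h != 0 -> \sum_(c < p) F (r + h *+ c) = \sum_c F c.
Proof.
move=> h0; rewrite (reindex (fun c : 'I_p => r + h *+ c)) //=.
apply: onW_bij; apply: inj_card_bij; last by rewrite card_Fp // card_ord.
move=> c c' /addrI; rewrite -mulr_natr -[h *+ c']mulr_natr => /(mulfI h0).
move/(congr1 val); rewrite /= !val_Fp_nat // !modn_small //.
exact: val_inj.
Qed.

Lemma sum_pred1 (I : finType) (z : I) : \sum_c (c == z)%:R = 1 :> int.
Proof. by rewrite (bigD1 z) //= eqxx big1 ?addr0 // => i /negPf->. Qed.

End Sums.

Section Cycles.
Variables (A B Q : finGroupType) (f : A -> Q) (g : B -> Q).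
Hypotheses (fM : {morph f : u v / u * v}) (gM : {morph g : u v / u * v}).
Variables (J : finType) (K : nat) (a : J -> nat -> A) (b : J -> nat -> B).
Hypothesis K0 : 0 < K.
Hypotheses (a1 : forall j i, a j i != 1).
Hypotheses (pa : forall j i, a j (K + i) = a j i)
           (pb : forall j i, b j (K + i) = b j i).
Let E j := ev (fun i => f (a j i)) (fun i => g (b j i)).
Let O j := od (fun i => f (a j i)) (fun i => g (b j i)).
Hypothesis sA : forall j n n' c, E j n' = E j n * f c -> n = n' %[mod K] /\ c = 1.
Hypothesis sB : forall j n n' c, O j n' = O j n * g c -> n = n' %[mod K] /\ c = 1.

(** The number of letter pairs after which the path of [j] in [Q] first closes up, by [E_eq]. *)
Definition cyc_len j := (K * #[E j K])%N.
Notation T := cyc_len.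

Lemma cyc_len_gt0 j : 0 < T j.
Proof. by rewrite muln_gt0 K0 order_gt0. Qed.

Let pf j i : f (a j (K + i)) = f (a j i). Proof. by rewrite pa. Qed.
Let pg j i : g (b j (K + i)) = g (b j i). Proof. by rewrite pb. Qed.

Lemma E_cyc j c m : E j (T j * c + m) = E j m.
Proof.
rewrite /T -mulnA /E ev_mulD; [|exact: pf|exact: pg].
by rewrite expgM expg_order expg1n mul1g.
Qed.

Lemma O_cyc j c m : O j (T j * c + m) = O j m.
Proof.
rewrite /T -mulnA /O od_mulD; [|exact: pf|exact: pg].
by rewrite expgM expg_order expg1n mul1g.
Qed.

Lemma E_mod j m : E j (m %% T j) = E j m.
Proof. by rewrite {2}(divn_eq m (T j)) mulnC E_cyc. Qed.
Lemma O_mod j m : O j (m %% T j) = O j m.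
Proof. by rewrite {2}(divn_eq m (T j)) mulnC O_cyc. Qed.

(** The hypothesis [sA] gives the congruence modulo [K]; what remains is a trivial power of [E j K],
    whose exponent is a multiple of the order. *)
Lemma E_eq j n n' : E j n = E j n' -> n = n' %[mod T j].
Proof.
wlog le : n n' / n <= n'.
  by move=> W; case: (leqP n n') => [/W//|/ltnW /W H /esym /H /esym].
move=> e; have [/eqP] : n' = n %[mod K] /\ (1 : A) = 1.
  by apply: (sA (j := j)); rewrite morph1_of // mulg1.
rewrite eqn_mod_dvd // => /dvdnP[r er] _.
have en : n' = (K * r + n)%N by lia.
move: e; rewrite en /E ev_mulD; [|exact: pf|exact: pg].
rewrite -[X in X = _]mul1g => /mulIg /esym/eqP; rewrite -order_dvdn => /dvdnP[c ->].
by rewrite mulnCA -/(T j) modnMDl.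
Qed.

Lemma O_eq j n n' : O j n = O j n' -> n = n' %[mod T j].
Proof.
move=> e; have [ek _] : n' = n %[mod K] /\ (1 : B) = 1.
  by apply: (sB (j := j)); rewrite morph1_of // mulg1.
apply: E_eq; move: e; rewrite /O /od (period_mod (pa j) ek).
exact: mulIg.
Qed.

Lemma EO_neq j n n' : E j n' != O j n.
Proof. by apply/eqP => /sA[_ e]; move: (a1 j n); rewrite e eqxx. Qed.

Definition evens q j := [set q * E j (i : nat).+1 | i : 'I_(T j)].
Definition odds q j := [set q * O j (i : nat) | i : 'I_(T j)].

Lemma evensP q j x : reflect (exists m, x = q * E j m.+1) (x \in evens q j).
Proof.
apply: (iffP imsetP) => [[i _ ->]|[m ->]]; first by exists i.
exists (Ordinal (ltn_pmod m (cyc_len_gt0 j))); first by [].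
change (q * E j m.+1 = q * E j (m %% T j).+1).
congr (q * _); rewrite -E_mod -[RHS]E_mod; congr (E j _).
by rewrite -addn1 -[(_ %% _).+1]addn1 modnDml.
Qed.

Lemma oddsP q j x : reflect (exists m, x = q * O j m) (x \in odds q j).
Proof.
apply: (iffP imsetP) => [[i _ ->]|[m ->]]; first by exists i.
exists (Ordinal (ltn_pmod m (cyc_len_gt0 j))); first by [].
by rewrite -O_mod.
Qed.

Lemma E_succ j m : E j m = E j (m + (T j).-1).+1.
Proof.
by rewrite -addnS prednK ?cyc_len_gt0 // -{1}(E_cyc j 1 m) muln1 addnC.
Qed.

Lemma mem_evens q j m : q * E j m \in evens q j.
Proof. by apply/evensP; eexists; rewrite E_succ. Qed.
Lemma mem_odds q j m : q * O j m \in odds q j.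
Proof. by apply/oddsP; exists m. Qed.

Lemma evens_odds q j x : x \in evens q j -> x \in odds q j = false.
Proof.
move=> /evensP[m ->]; apply/negP => /oddsP[n /mulgI/eqP].
by rewrite (negPf (EO_neq _ _ _)).
Qed.

Local Open Scope ring_scope.
Import GRing.Theory Num.Theory Order.TTheory.

(** The boundary of the sum of the [B]-edges of the cycle translated by [q]; pairing it with a
    weight gives the drift around that cycle. *)
Definition chain q j x : int := (x \in evens q j)%:R - (x \in odds q j)%:R.

Lemma chain_range q j x : [\/ chain q j x = 0, chain q j x = 1 | chain q j x = -1].
Proof.
rewrite /chain; case e: (x \in evens q j).
  by rewrite (evens_odds e); constructor 2.
by case: (x \in odds q j); [constructor 3|constructor 1].
Qed.

Lemma chain_evens q j x : (chain q j x == 1) = (x \in evens q j).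
Proof.
rewrite /chain; case e: (x \in evens q j); first by rewrite (evens_odds e).
by case: (x \in odds q j).
Qed.

Lemma chain_odds q j x : (chain q j x == -1) = (x \in odds q j).
Proof.
rewrite /chain; case e: (x \in evens q j); first by rewrite (evens_odds e).
by case: (x \in odds q j).
Qed.

(** By [E_eq] and [O_eq] no vertex is repeated within one turn, so sums over steps are sums over
    vertex sets. *)
Lemma holE (psi : Q -> int) q j :
  \sum_(i < T j) (psi (q * E j i.+1)%g - psi (q * O j i)%g) =
  \sum_x chain q j x * psi x.
Proof.
have mE (D : {set Q}) : \sum_(x in D) psi x = \sum_x (x \in D)%:R * psi x.
  by rewrite big_mkcond; apply: eq_bigr => x _; case: (x \in D); rewrite ?mul1r ?mul0r.
rewrite sumrB /chain; under [RHS]eq_bigr do rewrite mulrBl.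
rewrite sumrB -!mE /evens /odds; congr (_ - _); rewrite big_imset //=.
  move=> i i' _ _ /mulgI/(@E_eq _ i.+1 i'.+1)/eqP.
  by rewrite -[i.+1]addn1 -[i'.+1]addn1 eqn_modDr !modn_small // => /eqP/val_inj.
by move=> i i' _ _ /mulgI/O_eq; rewrite !modn_small // => /val_inj.
Qed.

(** * Cycles with equal or opposite chains *)

Section Pair.
Variables (u v : J).
Hypothesis nm_dir : ~ exists N, forall m,
   a v m = a u (N + m)%N /\ b v m = b u (N + m)%N.
Hypothesis nm_rev : ~ exists N, forall m x,
   ((x + m = N %[mod K])%N -> a v m * a u x = 1)%g /\
   ((x + m.+1 = N %[mod K])%N -> b v m * b u x = 1)%g.

(** Equal chains have the same even and the same odd vertices. From a common vertex on, [sA] and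
    [sB] force the [v]-cycle to follow the [u]-cycle letter by letter, so [v] is a shift of [u]. *)
Lemma chain_neq q : exists x, chain q v x != chain 1%g u x.
Proof.
apply/existsP; apply: contraT; rewrite negb_exists => /forallP H.
have {}H x : chain q v x = chain 1%g u x by apply/eqP; move: (H x); rewrite negbK.
have Ee x : (x \in evens q v) = (x \in evens 1%g u) by rewrite -!chain_evens H.
have Eo x : (x \in odds q v) = (x \in odds 1%g u) by rewrite -!chain_odds H.
case: nm_dir.
have := mem_evens q v 0; rewrite Ee => /evensP[N0]; rewrite mul1g.
move: (N0.+1) => N eN; exists N.
have main m : (q * E v m = E u (N + m) ->
  [/\ a v m = a u (N + m)%N, b v m = b u (N + m)%N & q * E v m.+1 = E u (N + m.+1)])%g.
  move=> em.
  have := mem_odds q v m; rewrite Eo => /oddsP[n]; rewrite mul1g => en.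
  (* The vertex [O u n] is reached by an [A]-edge from [E u n] and also from [E u (N + m)], so these
     lie in one coset of the image of [A]. *)
  have [mn eA] : (n = N + m %[mod K] /\ a u n * (a v m)^-1 = 1)%g.
    apply: (sA (j := u)); rewrite fM morphV_of // mulgA.
    by rewrite -[(E u n * _)%g]/(O u n) -en /O /od -em -!mulgA mulgV mulg1.
  have eA' : a v m = a u (N + m)%N.
    by rewrite -(period_mod (pa u) mn); apply/esym/eqP; rewrite eq_mulgV1 eA.
  have eO : (q * O v m = O u (N + m))%g by rewrite /O /od mulgA em eA'.
  have := mem_evens q v m.+1; rewrite Ee => /evensP[n']; rewrite mul1g => en'.
  have [mn' eB] : (n' = N + m %[mod K] /\ b u n' * (b v m)^-1 = 1)%g.
    apply: (sB (j := u)); rewrite gM morphV_of // mulgA.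
    by rewrite -[(O u n' * _)%g]/(E u n'.+1) -en' -eO -!mulgA mulgV mulg1.
  have eB' : b v m = b u (N + m)%N.
    by rewrite -(period_mod (pb u) mn'); apply/esym/eqP; rewrite eq_mulgV1 eB.
  by split=> //; rewrite /E !evS addnS evS mulgA -/(O v m) eO eB'.
have ind m : (q * E v m = E u (N + m))%g.
  by elim: m => [|m /main[]//]; rewrite addn0.
by move=> m; case: (main m (ind m)).
Qed.

(** Opposite chains exchange even and odd vertices: the [v]-cycle runs through the [u]-cycle
    backwards, reading the inverse letters. *)
Lemma chain_neqN q : exists x, chain q v x != - chain 1%g u x.
Proof.
apply/existsP; apply: contraT; rewrite negb_exists => /forallP H.
have {}H x : chain q v x = - chain 1%g u x by apply/eqP; move: (H x); rewrite negbK.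
have Ee x : (x \in evens q v) = (x \in odds 1%g u).
  by rewrite -chain_evens -chain_odds H eqr_oppLR.
have Eo x : (x \in odds q v) = (x \in evens 1%g u).
  by rewrite -chain_evens -chain_odds H eqr_opp.
case: nm_rev.
have := mem_evens q v 0; rewrite Ee => /oddsP[N]; rewrite mul1g => eN.
(* Modulo [T u] this [S m] is [N - m]: adding [(T u).-1] is one step back, without truncated
   subtraction. *)
exists N; pose S m := (N + (T u).-1 * m)%N.
have eS m : E u (S m) = E u (S m.+1).+1 by rewrite E_succ /S mulnS addnCA addnC.
have main m : (q * E v m = O u (S m) ->
  [/\ a v m * a u (S m) = 1, b v m * b u (S m.+1) = 1 & q * E v m.+1 = O u (S m.+1)])%g.
  move=> em.
  have := mem_odds q v m; rewrite Eo => /evensP[n]; rewrite mul1g => en.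
  have [mn eA] : (S m = n.+1 %[mod K] /\ a u (S m) * a v m = 1)%g.
    apply: (sA (j := u)); rewrite fM mulgA.
    by rewrite -[(E u (S m) * _)%g]/(O u (S m)) -em -mulgA -en.
  have eA' : (a v m * a u (S m) = 1)%g.
    by move/eqP: (eA); rewrite -eq_invg_mul => /eqP <-; rewrite mulVg.
  have eO : (q * O v m = E u (S m))%g.
    by rewrite /O /od mulgA em /O /od -mulgA -fM eA morph1_of // mulg1.
  have := mem_evens q v m.+1; rewrite Ee => /oddsP[n']; rewrite mul1g => en'.
  have [mn' eB] : (S m.+1 = n' %[mod K] /\ b u (S m.+1) * b v m = 1)%g.
    apply: (sB (j := u)); rewrite gM mulgA.
    by rewrite -[(O u (S m.+1) * _)%g]/(E u (S m.+1).+1) -eS -eO -mulgA -en'.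
  split=> //.
    by move/eqP: (eB); rewrite -eq_invg_mul => /eqP <-; rewrite mulVg.
  rewrite /E !evS mulgA -/(O v m) eO eS.
  by rewrite /E evS -/(O u _) -mulgA -gM eB morph1_of // mulg1.
have ind m : (q * E v m = O u (S m))%g.
  by elim: m => [|m /main[]//]; rewrite /S muln0 addn0.
have Smod m : (S m + m = N %[mod K])%N.
  have -> : (S m + m = T u * m + N)%N by rewrite /S; have := cyc_len_gt0 u; nia.
  by rewrite /cyc_len -mulnA mulnC modnMDl.
move=> m x; case: (main m (ind m)) => eA eB _; split=> ex.
  rewrite (period_mod (pa u) (_ : x = S m %[mod K])) //.
  by apply/eqP; rewrite -(eqn_modDr m) ex Smod.
rewrite (period_mod (pb u) (_ : x = S m.+1 %[mod K])) //.
by apply/eqP; rewrite -(eqn_modDr m.+1) ex Smod.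
Qed.

End Pair.


Variables (k : J -> nat) (u : J).
Hypotheses (k0 : forall j, (0 < k j)%N) (kK : forall j, (k j %| K)%N).
Hypotheses (pak : forall j i, a j (k j + i) = a j i)
           (pbk : forall j i, b j (k j + i) = b j i).
Hypothesis nm_dir : forall v, v != u -> ~ exists N, forall m,
   a v m = a u (N + m)%N /\ b v m = b u (N + m)%N.
Hypothesis nm_rev : forall v, v != u -> ~ exists N, forall m x,
   ((x + m = N %[mod K])%N -> a v m * a u x = 1)%g /\
   ((x + m.+1 = N %[mod K])%N -> b v m * b u x = 1)%g.

(** Only the [u]-cycle through 1 must have weight 0, because the second twist is supported over 1;
    the [v]-cycles are controlled at all translates [q]. *)
Lemma exists_holonomy : exists psi : Q -> int,
  \sum_x chain 1%g u x * psi x = 0 /\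
  forall v q, v != u -> \sum_x chain q v x * psi x != 0.
Proof.
have c1 q v : chain q v q = 1.
  by apply/eqP; rewrite chain_evens -{1}[q]mulg1 (mem_evens q v 0).
have [psi [psiu psiv]] := separating_weight (chain_range 1%g u) (c1 1%g u).
exists psi; split=> // v q vu; apply: psiv.
- exact: chain_range.
- by exists q; rewrite c1.
- exact: chain_neq (nm_dir vu) q.
- exact: chain_neqN (nm_rev vu) q.
Qed.

(** * The cover of degree [p] and the second twist *)

Section Levels.
Variables (psi : Q -> int) (p : nat).
Hypotheses (pr_p : prime p) (ltp : (\sum_x `|psi x| < p)%N).
Hypothesis psiu : \sum_x chain 1%g u x * psi x = 0.
Hypothesis psiv : forall v q, v != u -> \sum_x chain q v x * psi x != 0.

Let X := (Q * 'F_p)%type.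
Let F1 c : {perm X} := liftp 'F_p (rmul (f c)).
Let G1 c : {perm X} := twistp (fun q => (psi q)%:~R) (rmul (g c)).
Let W j := ev (fun i => F1 (a j i)) (fun i => G1 (b j i)).
Let WO j := od (fun i => F1 (a j i)) (fun i => G1 (b j i)).
Let hol j m q : int := \sum_(i < m) (psi (q * E j i.+1)%g - psi (q * O j i)%g).

Lemma WE j m q r : W j m (q, r) = ((q * E j m)%g, r + (hol j m q)%:~R).
Proof.
rewrite /W (ev_twist (fun q => (psi q)%:~R) (fun i => rmul (f (a j i)))
  (fun i => rmul (g (b j i)))).
have eE n : ev (fun i => rmul (f (a j i))) (fun i => rmul (g (b j i))) n
  = rmul (E j n) by rewrite (ev_morph (@rmul_morph Q)).
have eO n : od (fun i => rmul (f (a j i))) (fun i => rmul (g (b j i))) n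
  = rmul (O j n) by rewrite (od_morph (@rmul_morph Q)).
rewrite eE rmulE /drift /hol rmorph_sum /=; congr (_, _ + _).
by apply: eq_bigr => i _; rewrite eE eO !rmulE rmorphB.
Qed.

Lemma WOE j m q r : WO j m (q, r) = ((q * O j m)%g, r + (hol j m q)%:~R).
Proof. by rewrite /WO /od permM -/(W j m) WE liftpE rmulE mulgA. Qed.

Lemma W_cyc j q r :
  W j (T j) (q, r) = (q, r + (\sum_x chain q j x * psi x)%:~R).
Proof.
rewrite WE /hol holE; congr (_, _).
by rewrite -[T j]addn0 -[T j]muln1 E_cyc mulg1.
Qed.

(** Chain values have size at most 1, so this nonzero integer is smaller than [p] in size. *)
Lemma hol_neq0 v q : v != u -> ((\sum_x chain q v x * psi x)%:~R : 'F_p) != 0.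
Proof.
move=> vu; have := psiv q vu; set S := (\sum_x _) => S0.
have le : (`|S| <= \sum_x `|psi x|)%N.
  rewrite -lez_nat abszE (big_morph Posz PoszD (erefl _)).
  apply: le_trans (ler_norm_sum _ _ _) _; apply: ler_sum => x _.
  by rewrite normrM abszE; case: (chain_range q v x) => ->; rewrite ?normrN ?normr0 ?normr1; lia.
apply/negP => z; have : (`|S|%N%:R : 'F_p) == 0.
  by move: z; case: (S) => n; rewrite ?NegzE ?rmorphN /= ?oppr_eq0.
rewrite -(dvdn_pcharf (pchar_Fp pr_p)) => /dvdn_leq; rewrite absz_gt0 => /(_ S0).
by move/(leq_ltn_trans _): ltp => /(_ _ le); rewrite ltnNge => /negP.
Qed.

Let pF1 j i : F1 (a j (K + i)) = F1 (a j i). Proof. by rewrite pa. Qed.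
Let pG1 j i : G1 (b j (K + i)) = G1 (b j i). Proof. by rewrite pb. Qed.

Let pF1k j i : F1 (a j (k j + i)) = F1 (a j i). Proof. by rewrite pak. Qed.
Let pG1k j i : G1 (b j (k j + i)) = G1 (b j i). Proof. by rewrite pbk. Qed.

Lemma W_cyc_mul j c m : W j (T j * c + m) = (W j (T j) ^+ c * W j m)%g.
Proof.
rewrite /W /cyc_len -mulnA (ev_mulD (pF1 j) (pG1 j)).
by rewrite (ev_mul (pF1 j) (pG1 j)) expgM.
Qed.

Lemma W_cyc_exp j c q r : (W j (T j) ^+ c)%g (q, r) =
  (q, r + (\sum_x chain q j x * psi x)%:~R *+ c).
Proof.
elim: c r => [|c IH] r; first by rewrite perm1 addr0.
by rewrite expgS permM W_cyc IH mulrS addrA.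
Qed.


Let wt (z : X) : int := (z.1 == 1%g)%:R * ((z.2 == 0)%:R - (z.2 == 1)%:R).
Let D j m z : int := \sum_(i < m) (wt (W j i.+1 z) - wt (WO j i z)).

Section Top.
Variable L : nat.
Let F2 c : {perm X * 'Z_L} := liftp ('Z_L) (F1 c).
Let G2 c : {perm X * 'Z_L} := twistp (fun z => (wt z)%:~R) (G1 c).
Let V j := ev (fun i => F2 (a j i)) (fun i => G2 (b j i)).

Lemma VE j m z r : V j m (z, r) = (W j m z, r + (D j m z)%:~R).
Proof.
rewrite /V (ev_twist (fun z => (wt z)%:~R) (fun i => F1 (a j i))
  (fun i => G1 (b j i))) /drift /D rmorph_sum; congr (_, _ + _).
by apply: eq_bigr => i _; rewrite rmorphB.
Qed.

Let pF2 j i : F2 (a j (K + i)) = F2 (a j i). Proof. by rewrite pa. Qed.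
Let pG2 j i : G2 (b j (K + i)) = G2 (b j i). Proof. by rewrite pb. Qed.
Let pF2k j i : F2 (a j (k j + i)) = F2 (a j i). Proof. by rewrite pak. Qed.
Let pG2k j i : G2 (b j (k j + i)) = G2 (b j i). Proof. by rewrite pbk. Qed.

(* The orbits of [v] are invariant under translation in ['F_p], and [wt] sums
   to zero along every translation orbit. *)
Lemma V_cyc_exp v : v != u -> (V v (T v) ^+ p = 1)%g.
Proof.
move=> vu; apply/permP => -[[q r] y]; rewrite perm1.
rewrite (iter_twist (VE v (T v))) W_cyc_exp.
have ch z : z *+ p = 0 :> 'F_p by rewrite mulrn_pchar // pchar_Fp.
rewrite ch addr0; congr (_, _).
suff -> : \sum_(i < p) (D v (T v) ((W v (T v) ^+ i)%g (q, r)))%:~R = 0 :> 'Z_L.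
  by rewrite addr0.
rewrite -rmorph_sum /= /D exchange_big /= big1 ?rmorph0 // => i _.
set h := ((\sum_x chain q v x * psi x)%:~R : 'F_p).
have h0 : h != 0 by apply: hol_neq0.
have key (q' : Q) (r' : 'F_p) : \sum_(c < p) wt (q', r' + h *+ c) = 0.
  rewrite (sum_Fp_translate pr_p r' (fun z => wt (q', z)) h0) /wt /= -mulr_sumr.
  by rewrite sumrB !sum_pred1 subrr mulr0.
rewrite sumrB; have Wc c : (W v (T v) ^+ c)%g (q, r) = (q, r + h *+ c).
  by rewrite W_cyc_exp.
under eq_bigr do rewrite Wc WE addrAC.
under [X in _ - X]eq_bigr do rewrite Wc WOE addrAC.
by rewrite !key subrr.
Qed.

(** [T v] is a multiple of [k v], and the order of [E v K] divides [#|Q|]; the resulting bound does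
    not involve [L]. *)
Lemma order_V v : v != u -> (#[V v (k v)] %| K * #|Q| * p)%N.
Proof.
move=> vu; have /dvdnP[c ec] := kK v.
have e : (V v (k v) ^+ (c * #[E v K] * p) = 1)%g.
  rewrite expgM -(ev_mul (pF2k v) (pG2k v)) -/(V v).
  have -> : (k v * (c * #[E v K]))%N = T v by rewrite /cyc_len ec; lia.
  exact: V_cyc_exp.
apply: (@dvdn_trans (c * #[E v K] * p)); first by rewrite order_dvdn e.
rewrite dvdn_pmul2r ?prime_gt0 // dvdn_mul //; first by rewrite ec dvdn_mulr.
by rewrite -cardsT order_dvdG ?inE.
Qed.

Hypothesis L1 : (1 < L)%N.
Let d := #[W u (k u)].
Let gcdD := \big[gcdn/0%N]_z `|D u (k u * d) z|%N.

(** The [d]-th power fixes [X] and translates the fibre over [z] by [D u (k u * d) z]. Its [c]-th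
    power is trivial exactly when [L] divides [c] times each of these numbers, that is,
    [gcdD * c]. *)
Lemma order_Vu N : L = (gcdD * N)%N -> #[V u (k u)] = (d * N)%N.
Proof.
move=> eL.
have Wd : (W u (k u * d) = 1)%g.
  by rewrite /W (ev_mul (pF1k u) (pG1k u)) expg_order.
have VdE c z r : (V u (k u) ^+ (d * c))%g (z, r) =
    (z, r + (D u (k u * d) z)%:~R *+ c).
  rewrite expgM -(ev_mul (pF2k u) (pG2k u)) -/(V u).
  rewrite (iter_twist (VE u (k u * d))) Wd expg1n perm1; congr (_, _ + _).
  under eq_bigr do rewrite expg1n perm1.
  by rewrite sumr_const card_ord.
have Lzero (x : int) c : ((x%:~R *+ c : 'Z_L) == 0) = (L %| `|x| * c)%N.
  (* This relies on [1 < L], since ['Z_L] has at least two elements whatever [L] is. *)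
  have nat0 n : ((n%:R : 'Z_L) == 0) = (L %| n)%N.
    by rewrite -val_eqE /= val_Zp_nat // /dvdn.
  rewrite -nat0 natrM -[x%:~R *+ c]mulr_natr; case: x => n; rewrite ?NegzE //.
  by rewrite mulrNz abszN mulNr oppr_eq0.
have dvdP n : (#[V u (k u)] %| n)%N = (d * N %| n)%N.
  rewrite order_dvdn; apply/eqP/idP => [wn|/dvdnP[c ->]].
    have /dvdnP[c en] : (d %| n)%N.
      rewrite order_dvdn; apply/eqP/permP => z; rewrite perm1.
      have := congr1 (fun s : {perm X * 'Z_L} => (s (z, 0)).1) wn.
      by rewrite (iter_twist (VE u (k u))) perm1.
    have Dz z : (L %| `|D u (k u * d) z| * c)%N.
      rewrite -Lzero.
      have := congr1 (fun s : {perm X * 'Z_L} => (s (z, 0)).2) wn.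
      by rewrite en mulnC VdE perm1 /= add0r => ->.
    have : (L %| gcdD * c)%N.
      rewrite /gcdD; apply: (big_ind (fun y => (L %| y * c)%N)) => //.
      by move=> y y' h h'; rewrite muln_gcdl dvdn_gcd h.
    rewrite eL dvdn_pmul2l; first by rewrite en mulnC => h; rewrite dvdn_mul.
    by move: L1; rewrite eL; case: (gcdD).
  apply/permP => -[z r]; rewrite perm1.
  have -> : (c * (d * N) = d * (N * c))%N by lia.
  rewrite VdE; congr (_, _); apply/eqP; rewrite -[X in _ == X]addr0 (inj_eq (addrI _)).
  rewrite Lzero eL mulnA dvdn_mulr // dvdn_mul //.
  by rewrite /gcdD (bigD1 z) //= dvdn_gcdl.
by apply/eqP; rewrite eqn_dvd dvdP dvdnn -dvdP dvdnn.
Qed.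

End Top.

(** The [u]-cycle has holonomy 0, so its lift through [(1, 0)] closes up and misses [(1, 1)], and
    its odd vertices never lie over 1. Each return to [(1, 0)] counts 1, and the last step is a
    return. *)
Lemma D_pos : 0 < D u (k u * #[W u (k u)]) (1%g, 0).
Proof.
set n := (k u * _)%N.
have Wn : (W u n = 1)%g by rewrite /W (ev_mul (pF1k u) (pG1k u)) expg_order.
have E1 i : E u i = 1%g -> W u i (1%g, 0) = (1%g, 0).
  move=> e; have : i = 0%N %[mod T u] by apply: E_eq; rewrite e.
  rewrite mod0n => /eqP/dvdnP[c ->].
  have -> : (c * T u = T u * c + 0)%N by rewrite addn0 mulnC.
  rewrite W_cyc_mul permM W_cyc_exp psiu mul0rn addr0.
  by rewrite perm1.
have tE i : wt (W u i (1%g, 0)) = (E u i == 1%g)%:R.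
  case: eqP => [/E1->|]; first by rewrite /wt /= !eqxx subr0 mulr1.
  by move=> /eqP/negPf ne; rewrite WE /wt /= mul1g ne mul0r.
have tO i : wt (WO u i (1%g, 0)) = 0.
  rewrite WOE /wt /= mul1g eq_sym -[1%g]/(E u 0).
  by rewrite (negPf (EO_neq _ _ _)) mul0r.
have n0 : (0 < n)%N by rewrite muln_gt0 k0 order_gt0.
rewrite /D; under eq_bigr do rewrite tE tO subr0.
case: n n0 Wn => // n _ Wn.
rewrite big_ord_recr /= ltr_wpDl ?sumr_ge0 //.
have := congr1 (fun s : {perm X} => (s (1%g, 0)).1) Wn.
by rewrite WE perm1 /= mul1g => ->; rewrite eqxx.
Qed.

Lemma independence_of_levels : exists M : nat, forall l : nat, (0 < l)%N ->
  exists (R : finGroupType) (F : A -> R) (G : B -> R),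
    [/\ {morph F : c c' / c * c'}%g, {morph G : c c' / c * c'}%g,
       #[ev (fun i => F (a u i)) (fun i => G (b u i)) (k u)] = (M * l)%N &
       forall v, v != u ->
         (#[ev (fun i => F (a v i)) (fun i => G (b v i)) (k v)] %| M)%N].
Proof.
pose d := #[W u (k u)]; pose e := (K * #|Q| * p)%N.
pose gcdD := \big[gcdn/0%N]_z `|D u (k u * d) z|%N.
have e1 : (1 < e)%N.
  rewrite /e (leq_trans (prime_gt1 pr_p)) // leq_pmull // muln_gt0 K0 /=.
  by apply/card_gt0P; exists 1%g.
have gcd0 : (0 < gcdD)%N.
  have Dp := D_pos; rewrite /gcdD (bigD1 (1%g, 0)) //= gcdn_gt0.
  by apply/orP; left; rewrite absz_gt0 gt_eqF.
(* With this [L] the order of [u] is [d * (e * l)], while the other orders divide [e]. *)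
exists (d * e)%N => l l0; pose L := (gcdD * (e * l))%N.
have L1 : (1 < L)%N.
  rewrite (leq_trans e1) // (leq_trans (leq_pmulr e l0)) //.
  exact: leq_pmull.
exists {perm X * 'Z_L}, (fun c => liftp ('Z_L) (F1 c)),
  (fun c => twistp (fun z => (wt z)%:~R) (G1 c)); split.
- by move=> c c'; rewrite -liftp_morph /F1 fM rmul_morph liftp_morph.
- by move=> c c'; rewrite -twistp_morph /G1 gM rmul_morph twistp_morph.
- by rewrite (order_Vu L1 (erefl _)) -mulnA.
- by move=> v vu; apply: dvdn_trans (order_V L vu) _; apply: dvdn_mull.
Qed.

End Levels.

Lemma independence_of_cycles : exists M : nat, forall l : nat, (0 < l)%N ->
  exists (R : finGroupType) (F : A -> R) (G : B -> R),
    [/\ {morph F : c c' / c * c'}%g, {morph G : c c' / c * c'}%g,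
       #[ev (fun i => F (a u i)) (fun i => G (b u i)) (k u)] = (M * l)%N &
       forall v, v != u ->
         (#[ev (fun i => F (a v i)) (fun i => G (b v i)) (k v)] %| M)%N].
Proof.
have [psi [psiu psiv]] := exists_holonomy.
have [p ltp pr_p] := prime_above (\sum_x `|psi x|).
exact: independence_of_levels pr_p ltp psiu psiv.
Qed.
End Cycles.

(** * Periodic words in a free product *)

(** The permutation group of the glued set serves as [Q], all words being read with the common
    period [K]. *)
Lemma finite_independence (A B : finGroupType) (J : finType) (K : nat)
  (a : J -> nat -> A) (b : J -> nat -> B) (k : J -> nat) (u : J) :
  0 < K -> (forall j i, a j i != 1) -> (forall j i, b j i != 1) ->
  (forall j, 0 < k j) -> (forall j, k j %| K) ->
  (forall j i, a j (k j + i) = a j i) -> (forall j i, b j (k j + i) = b j i) ->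
  (forall v, v != u -> ~ exists N, forall m,
     a v m = a u (N + m) /\ b v m = b u (N + m)) ->
  (forall v, v != u -> ~ exists N, forall m x,
     (x + m = N %[mod K] -> a v m * a u x = 1) /\
     (x + m.+1 = N %[mod K] -> b v m * b u x = 1)) ->
  exists M : nat, forall l : nat, 0 < l ->
  exists (R : finGroupType) (F : A -> R) (G : B -> R),
    [/\ {morph F : c c' / c * c'}, {morph G : c c' / c * c'},
       #[ev (fun i => F (a u i)) (fun i => G (b u i)) (k u)] = (M * l)%N &
       forall v, v != u ->
         #[ev (fun i => F (a v i)) (fun i => G (b v i)) (k v)] %| M].
Proof.
move=> K0 a1 b1 k0 kK pak pbk nmd nmr.
have per C (z : J -> nat -> C) :
    (forall j i, z j (k j + i) = z j i) -> forall j i, z j (K + i) = z j i.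
  move=> pz j i; have /dvdnP[c ->] := kK j; rewrite mulnC.
  exact: period_mulD.
have pa := per _ _ pak; have pb := per _ _ pbk.
exact: (independence_of_cycles (@permA_morph A B J K) (permB_morph K a1 b1) K0 a1
  pa pb (simpleA K0 pa pb) (simpleB K0 pa pb) k0 kK pak pbk nmd nmr).
Qed.

Section AGroup.
Variable G : agroup.
Implicit Types x y z c g : G.
Local Notation "x ** y" := (gmul x y) (at level 40, left associativity).
Local Notation "1" := gone.
Local Notation "x '^i'" := (ginv x) (at level 3, format "x '^i'").

Lemma gmulK x y : x^i ** (x ** y) = y.
Proof. by rewrite gmulA gmulV gmul1. Qed.

Lemma gmul_inj x : injective (gmul x).
Proof. by move=> y z e; rewrite -(gmulK x y) e gmulK. Qed.

Lemma gmulg1 x : x ** 1 = x.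
Proof. by apply: (@gmul_inj x^i); rewrite gmulK gmulV. Qed.

Lemma gmulgV x : x ** x^i = 1.
Proof. by apply: (@gmul_inj x^i); rewrite gmulK gmulg1. Qed.

Lemma gmulVK x y : x ** (x^i ** y) = y.
Proof. by rewrite gmulA gmulgV gmul1. Qed.

Lemma ginv_eq x y : x ** y = 1 -> x^i = y.
Proof. by move=> e; rewrite -[RHS](gmulK x) e gmulg1. Qed.

Lemma ginvK x : x^i^i = x.
Proof. by apply: ginv_eq; rewrite gmulV. Qed.

Lemma ginvM x y : (x ** y)^i = y^i ** x^i.
Proof. by apply: ginv_eq; rewrite -gmulA gmulVK gmulgV. Qed.

Lemma ginv1 : 1^i = 1 :> G.
Proof. by apply: ginv_eq; rewrite gmul1. Qed.

Lemma gconjM g x y : gconj g (x ** y) = gconj g x ** gconj g y.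
Proof. by rewrite /gconj -!gmulA gmulVK. Qed.

Lemma gconj1 x : gconj 1 x = x.
Proof. by rewrite /gconj ginv1 gmul1 gmulg1. Qed.

Lemma gconjg1 g : gconj g 1 = 1.
Proof. by rewrite /gconj gmul1 gmulV. Qed.

Lemma gconj_gmul g h x : gconj h (gconj g x) = gconj (g ** h) x.
Proof. by rewrite /gconj ginvM -!gmulA. Qed.

Lemma gconjV g x : gconj g x^i = (gconj g x)^i.
Proof. by symmetry; apply: ginv_eq; rewrite -gconjM gmulgV gconjg1. Qed.

Lemma gconj_mulC x y : gconj x (x ** y) = y ** x.
Proof. by rewrite /gconj -gmulA gmulK. Qed.

Lemma gpowD x m n : gpow x (m + n) = gpow x m ** gpow x n.
Proof. by elim: m => [|m IH] /=; rewrite ?gmul1 // IH gmulA. Qed.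

Lemma gpowSr x n : gpow x n.+1 = gpow x n ** x.
Proof. by rewrite -addn1 gpowD /= gmulg1. Qed.

Lemma gpow_inv x n : gpow x^i n = (gpow x n)^i.
Proof. by elim: n => [|n IH]; rewrite ?ginv1 //= IH -ginvM -gpowSr. Qed.

Lemma gconj_gpow g x n : gconj g (gpow x n) = gpow (gconj g x) n.
Proof. by elim: n => [|n IH] /=; rewrite ?gconjg1 // gconjM IH. Qed.

Lemma in_cyclic_conj g c x : in_cyclic c x -> in_cyclic (gconj g c) (gconj g x).
Proof.
by move=> [n [->|->]]; exists n; rewrite gconj_gpow ?gconjV; [left|right].
Qed.

Lemma in_cyclic_inv c x : in_cyclic c x^i -> in_cyclic c x.
Proof.
by rewrite -{2}[x]ginvK => -[n [->|->]]; exists n; rewrite -gpow_inv ?ginvK;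
  [right|left].
Qed.

Lemma gmul_eq1C x y : x ** y = 1 -> y ** x = 1.
Proof. by move=> /ginv_eq <-; rewrite gmulV. Qed.

Variables (s t : nat -> G).
Fixpoint gev (m : nat) : G :=
  match m with 0 => 1 | m'.+1 => gev m' ** (s m' ** t m') end.

Lemma gev_period d m : (forall i, s (d + i) = s i) -> (forall i, t (d + i) = t i) ->
  gev (d + m) = gev d ** gev m.
Proof.
move=> ps pt; elim: m => [|m IH]; first by rewrite addn0 gmulg1.
by rewrite addnS /= IH ps pt -!gmulA.
Qed.

Lemma gev_mul d n : (forall i, s (d + i) = s i) -> (forall i, t (d + i) = t i) ->
  gev (d * n) = gpow (gev d) n.
Proof.
move=> ps pt; elim: n => [|n IH]; first by rewrite muln0.
by rewrite mulnS gev_period // IH.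
Qed.

End AGroup.

Lemma gcd_period (C : Type) (z : nat -> C) k k' : 0 < k ->
  (forall i, z (k + i) = z i) -> (forall i, z (k' + i) = z i) ->
  forall i, z (gcdn k k' + i) = z i.
Proof.
move=> k0 pk pk' i; have [y y' e _] := egcdnP k' k0.
rewrite -[LHS](period_mulD pk' y') addnA (mulnC k') -e mulnC.
exact: period_mulD.
Qed.

(** By Bezout, [gcdn k k'] is also a period, and both elements are powers of the prefix of that
    length. *)
Lemma gev_fine_wilf (G : agroup) (s t : nat -> G) k k' : 0 < k ->
  (forall i, s (k + i) = s i) -> (forall i, t (k + i) = t i) ->
  (forall i, s (k' + i) = s i) -> (forall i, t (k' + i) = t i) ->
  exists c, in_cyclic c (gev s t k) /\ in_cyclic c (gev s t k').
Proof.
move=> k0 psk ptk psk' ptk'; exists (gev s t (gcdn k k')).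
have ps := gcd_period k0 psk psk'; have pt := gcd_period k0 ptk ptk'.
have [/dvdnP[c ec] /dvdnP[c' ec']] := (dvdn_gcdl k k', dvdn_gcdr k k').
split.
  by exists c; left; rewrite -gev_mul // mulnC -ec.
by exists c'; left; rewrite -gev_mul // mulnC -ec'.
Qed.

Lemma hom_one (G H : agroup) (f : G -> H) : is_hom f -> f gone = gone.
Proof. by move=> fM; apply: (@gmul_inj _ (f gone)); rewrite -fM gmulg1 gmulg1. Qed.

Definition gconjugate (G : agroup) (x y : G) := exists g, x = gconj g y.

Lemma gconjugate_trans (G : agroup) (x y z : G) :
  gconjugate x y -> gconjugate y z -> gconjugate x z.
Proof. by move=> [g ->] [h ->]; exists (gmul h g); rewrite gconj_gmul. Qed.

Lemma gconjugate_sym (G : agroup) (x y : G) : gconjugate x y -> gconjugate y x.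
Proof.
by move=> [g ->]; exists (ginv g); rewrite gconj_gmul gmulgV gconj1.
Qed.

Lemma gconjugate_refl (G : agroup) (x : G) : gconjugate x x.
Proof. by exists gone; rewrite gconj1. Qed.

Lemma gconjugate_mulC (G : agroup) (x y : G) : gconjugate (gmul x y) (gmul y x).
Proof. by apply: gconjugate_sym; exists x; rewrite gconj_mulC. Qed.

Lemma common_cyclic (G : agroup) (c X Y x y : G) :
  in_cyclic c X -> in_cyclic c Y -> gconjugate x X -> gconjugate y Y ->
  exists d h, in_cyclic d x /\ in_cyclic (gconj h d) y.
Proof.
move=> cX cY [g ->] [h ->]; exists (gconj g c), (gmul (ginv g) h).
by rewrite gconj_gmul gmulVK; split; apply: in_cyclic_conj.
Qed.

(** * From matching words to conjugate cyclic subgroups *)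

Section Match.
Variables (A B G : agroup) (iA : A -> G) (iB : B -> G).
Hypotheses (hA : is_hom iA) (hB : is_hom iB).
Variables (a a' : nat -> A) (b b' : nat -> B) (k k' : nat).
Hypothesis k0' : 0 < k'.
Hypotheses (pa : forall i, a (k + i) = a i) (pb : forall i, b (k + i) = b i).
Hypotheses (pa' : forall i, a' (k' + i) = a' i) (pb' : forall i, b' (k' + i) = b' i).
Let S i := iA (a i). Let T i := iB (b i).
Let S' i := iA (a' i). Let T' i := iB (b' i).
Let pS i : S (k + i) = S i. Proof. by rewrite /S pa. Qed.
Let pT i : T (k + i) = T i. Proof. by rewrite /T pb. Qed.
Let pS' i : S' (k' + i) = S' i. Proof. by rewrite /S' pa'. Qed.
Let pT' i : T' (k' + i) = T' i. Proof. by rewrite /T' pb'. Qed.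
Variables x y : G.
Hypotheses (cx : gconjugate x (gev S T k)) (cy : gconjugate y (gev S' T' k')).

(** The shifted word inherits the period [k], so [gev_fine_wilf] applies to it; and [gev S' T' k] is
    conjugate to [gev S T k] through the prefix [gev S T N]. *)
Lemma match_dir N : (forall m, a' m = a (N + m) /\ b' m = b (N + m)) ->
  exists c h, in_cyclic c x /\ in_cyclic (gconj h c) y.
Proof.
move=> H.
have qS i : S' (k + i) = S' i.
  by rewrite /S' !(proj1 (H _)) addnCA pa.
have qT i : T' (k + i) = T' i.
  by rewrite /T' !(proj2 (H _)) addnCA pb.
have [c [c1 c2]] := gev_fine_wilf k0' pS' pT' qS qT.
apply: (common_cyclic c2 c1) cy; apply: (gconjugate_trans cx).
have e m : gmul (gev S T N) (gev S' T' m) = gev S T (N + m).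
  elim: m => [|m IH]; first by rewrite addn0 gmulg1.
  by rewrite addnS /= -IH /S' /T' (proj1 (H m)) (proj2 (H m)) -!gmulA.
apply: gconjugate_sym; exists (gev S T N).
by rewrite /gconj -gev_period // addnC -e gmulK.
Qed.

(** Appending the primed word to an odd prefix of the other word erases that prefix from its end.
    Erasing one period shows that the inverse of [gev S' T' k] is conjugate to [gev S T k]. *)
Lemma match_rev K N : 0 < K ->
  (forall m z, (z + m = N %[mod K] -> gmul (a' m) (a z) = gone) /\
     (z + m.+1 = N %[mod K] -> gmul (b' m) (b z) = gone)) ->
  exists c h, in_cyclic c x /\ in_cyclic (gconj h c) y.
Proof.
case: K => // K _ H.
have cancel (C : agroup) (p q r : C) : gmul p r = gone -> gmul q r = gone -> p = q.
  by move=> /ginv_eq <-; move/ginv_eq => e; rewrite -[q]ginvK e ginvK.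
have qS i : S' (k + i) = S' i.
  (* The modulus is now [K.+1], so [K] acts as -1 and [z] is congruent to [N - (k + i)]. *)
  pose z := N + K * (k + i); congr iA; apply: (cancel _ _ _ (a z)).
    apply: (proj1 (H _ _)).
    have -> : z + (k + i) = (k + i) * K.+1 + N by rewrite /z; nia.
    by rewrite modnMDl.
  rewrite -pa; apply: (proj1 (H _ _)).
  have -> : k + z + i = (k + i) * K.+1 + N by rewrite /z; nia.
  by rewrite modnMDl.
have qT i : T' (k + i) = T' i.
  pose z := N + K * (k + i).+1; congr iB; apply: (cancel _ _ _ (b z)).
    apply: (proj2 (H _ _)).
    have -> : z + (k + i).+1 = (k + i).+1 * K.+1 + N by rewrite /z; nia.
    by rewrite modnMDl.
  rewrite -pb; apply: (proj2 (H _ _)).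
  have -> : k + z + i.+1 = (k + i).+1 * K.+1 + N by rewrite /z; nia.
  by rewrite modnMDl.
have [c [c1 c2]] := gev_fine_wilf k0' pS' pT' qS qT.
have nm0 : N + K.+1 * k = N %[mod K.+1] by rewrite mulnC addnC modnMDl.
pose gO m := gmul (gev S T m) (S m).
have e m n : n + m = N + K.+1 * k -> gmul (gO (n + m)) (gev S' T' m) = gO n.
  elim: m n => [|m IH] n nm; first by rewrite addn0 gmulg1.
  rewrite addnS -addSn /= gmulA IH ?addSnnS // /gO /=.
  have nm' : n.+1 + m = N %[mod K.+1] by rewrite addSnnS nm nm0.
  have nm2 : n + m.+1 = N %[mod K.+1] by rewrite nm nm0.
  have /(congr1 iA) eA := proj1 (H m n.+1) nm'.
  have /(congr1 iB) eB := proj2 (H m n) nm2.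
  rewrite hA (hom_one hA) in eA; rewrite hB (hom_one hB) in eB.
  have {}eA := gmul_eq1C eA; have {}eB := gmul_eq1C eB.
  by rewrite -!gmulA (gmulA (S n.+1)) eA gmul1 eB gmulg1.
(* Then [M + k] is [N + K.+1 * k], congruent to [N] and large enough for [k] steps back. *)
pose M := N + K * k.
have {e} : gmul (gO (k + M)) (gev S' T' k) = gO M.
  by rewrite addnC e // /M mulSn; lia.
rewrite /gO gev_period // pS -!gmulA !(gmulA (gev S T M)) -/(gO M) => e.
apply: (common_cyclic (X := ginv (gev S' T' k)) _ c1) cy.
  by apply: in_cyclic_inv; rewrite ginvK.
apply: (gconjugate_trans cx); apply: gconjugate_sym.
exists (gO M); apply/ginv_eq/gmul_eq1C.
by rewrite /gconj -!gmulA (gmulA (gev S T M)) e gmulV.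
Qed.

End Match.

(** * Cyclic normal forms in a free product *)

Section FreeProduct.
Variables (A B G : agroup) (iA : A -> G) (iB : B -> G).
Hypothesis hfp : is_free_product iA iB.
Let hA : is_hom iA. Proof. by case: hfp. Qed.
Let hB : is_hom iB. Proof. by case: hfp => _ []. Qed.

(** Letters may be trivial, so every element of a factor is a word of one pair. *)
Fixpoint wev (w : seq (A * B)) : G :=
  if w is p :: w' then gmul (gmul (iA p.1) (iB p.2)) (wev w') else gone.

Lemma wev_cat w w' : wev (w ++ w') = gmul (wev w) (wev w').
Proof. by elim: w => [|p w IH] /=; rewrite ?gmul1 // IH gmulA. Qed.

Definition spanned (x : G) : Prop := exists w, x = wev w.

Lemma spannedM x y : spanned x -> spanned y -> spanned (gmul x y).
Proof. by move=> [w ->] [w' ->]; exists (w ++ w'); rewrite wev_cat. Qed.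

Lemma spanned1 : spanned gone. Proof. by exists [::]. Qed.

Lemma spannedA a : spanned (iA a).
Proof. by exists [:: (a, gone)]; rewrite /= (hom_one hB) !gmulg1. Qed.

Lemma spannedB b : spanned (iB b).
Proof. by exists [:: (gone, b)]; rewrite /= (hom_one hA) gmul1 gmulg1. Qed.

Lemma homV (H K : agroup) (f : H -> K) : is_hom f ->
  forall x, f (ginv x) = ginv (f x).
Proof. by move=> fM x; apply/esym/ginv_eq; rewrite -fM gmulgV hom_one. Qed.

Lemma spannedV x : spanned x -> spanned (ginv x).
Proof.
move=> [w ->]; elim: w => [|[a b] w IH] /=; first by rewrite ginv1; apply: spanned1.
rewrite !ginvM -!homV //; apply: spannedM => //.
by apply: spannedM; [apply: spannedB|apply: spannedA].
Qed.

Let sub_eq (x y : {x : G | spanned x}) : sval x = sval y -> x = y.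
Proof.
by case: x y => [x sx] [y sy] /= e; subst y; rewrite (Prop_irrelevance sx sy).
Qed.

Definition span_group : agroup.
Proof.
apply: (@AGroup {x : G | spanned x}
  (fun x y => exist _ _ (spannedM (svalP x) (svalP y))) (exist _ _ spanned1)
  (fun x => exist _ _ (spannedV (svalP x)))) => *; apply: sub_eq => /=.
- exact: gmulA.
- exact: gmul1.
- exact: gmulV.
Defined.

(* The identity of [G] and the retraction of [G] onto the subgroup spanned by
   the factors agree on the factors, hence are equal. *)
Lemma free_product_spanned x : spanned x.
Proof.
case: hfp => _ [_ U].
have U1 := U span_group (fun a => exist _ _ (spannedA a)) (fun b => exist _ _ (spannedB b)).
have [||h [[hM [h1 h2]] _]] := U1.
- by move=> a a'; apply: sub_eq => /=.
- by move=> a a'; apply: sub_eq => /=.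
have [h' [_ uniq_h]] := U G iA iB hA hB.
have e1 : h' = id by apply: uniq_h.
have e2 : h' = (fun y => sval (h y)).
  apply: uniq_h; split; first by move=> y z; rewrite hM.
  by split=> c; rewrite ?h1 ?h2.
have := congr1 (fun f => f x) e2; rewrite e1 /= => ->; exact: (svalP (h x)).
Qed.

Let p0 : A * B := (gone, gone).
Definition nontrivial_pair (p : A * B) := p.1 <> gone /\ p.2 <> gone.

Lemma bad_pair w : (forall m, m < size w -> nontrivial_pair (nth p0 w m)) \/
  exists w1 p w2, w = w1 ++ p :: w2 /\ (p.1 = gone \/ p.2 = gone).
Proof.
elim: w => [|p w IH]; first by left.
have [p1|p1] := pselect (p.1 = gone); first by right; exists [::], p, w; split; [|left].
have [p2|p2] := pselect (p.2 = gone); first by right; exists [::], p, w; split; [|right].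
case: IH => [H|[w1 [q [w2 [-> H]]]]]; last by right; exists (p :: w1), q, w2.
by left=> -[|m] // /H.
Qed.

(** Induction on the length. A pair with a trivial letter is rotated to the front, and its other
    letter is absorbed by the cyclic neighbour from the same factor; if no other pair is left, [x]
    is conjugate into a factor. *)
Lemma cyclic_reduction w x : gconjugate x (wev w) ->
  [\/ exists a, gconjugate x (iA a), exists b, gconjugate x (iB b) |
    exists w', [/\ 0 < size w', gconjugate x (wev w') &
      forall m, m < size w' -> nontrivial_pair (nth p0 w' m)]].
Proof.
have [n] := ubnP (size w); elim: n w x => // n IH w x ltn cx.
have [good|[w1 [p [w2 [ew bad]]]]] := bad_pair w.
  case: w => [|q w] in ltn cx good *.
    by constructor 1; exists gone; rewrite (hom_one hA).
  by constructor 3; exists (q :: w).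
have {}cx : gconjugate x (wev (p :: (w2 ++ w1))).
  apply: (gconjugate_trans cx); rewrite ew -cat_cons wev_cat [wev ((p :: w2) ++ w1)]wev_cat.
  exact: gconjugate_mulC.
have sz : size (w2 ++ w1) = (size w).-1 by rewrite ew !size_cat /= addnS addnC.
have szw : size w = (size w).-1.+1 by rewrite ew size_cat /= addnS.
move: (w2 ++ w1) sz cx => t sz cx.
case: bad => bad.
  case: (lastP t) => [|t' q] in sz cx *.
    by constructor 2; exists p.2; move: cx; rewrite /= bad (hom_one hA) gmul1 gmulg1.
  (* The pair moves cyclically behind [q], whose [B]-letter absorbs [p.2]. *)
  apply: (IH (rcons t' (q.1, gmul q.2 p.2))).
    by rewrite size_rcons; rewrite size_rcons in sz; lia.
  apply: (gconjugate_trans cx) => /=.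
  apply: (gconjugate_trans (gconjugate_mulC _ _)).
  rewrite bad (hom_one hA) gmul1 -!cats1 !wev_cat /= !gmulg1 hB -!gmulA.
  exact: gconjugate_refl.
case: t sz cx => [|q t] sz cx.
  by constructor 1; exists p.1; move: cx; rewrite /= bad (hom_one hB) !gmulg1.
apply: (IH ((gmul p.1 q.1, q.2) :: t)); first by move: sz => /=; lia.
by move: cx; rewrite /= bad (hom_one hB) gmulg1 hA -!gmulA.
Qed.

Lemma wev_gev w m : m <= size w ->
  wev (take m w) = gev (fun i => iA (nth p0 w i).1) (fun i => iB (nth p0 w i).2) m.
Proof.
elim: m => [|m IH] ltm; first by rewrite take0.
by rewrite (take_nth p0) // -cats1 wev_cat IH 1?ltnW //= gmulg1.
Qed.

Lemma eq_gev (s t s' t' : nat -> G) m : (forall i, i < m -> s i = s' i) ->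
  (forall i, i < m -> t i = t' i) -> gev s t m = gev s' t' m.
Proof.
elim: m => //= m IH es et; rewrite IH ?es ?et // => i lt.
  by apply: es; apply: ltnW.
by apply: et; apply: ltnW.
Qed.

Lemma cyclic_form x : ~ (exists a, gconjugate x (iA a)) ->
  ~ (exists b, gconjugate x (iB b)) ->
  exists z : nat * (nat -> A) * (nat -> B),
   [/\ 0 < z.1.1, forall i, z.1.2 (z.1.1 + i) = z.1.2 i /\ z.2 (z.1.1 + i) = z.2 i,
    forall i, z.1.2 i <> gone /\ z.2 i <> gone &
    gconjugate x (gev (fun i => iA (z.1.2 i)) (fun i => iB (z.2 i)) z.1.1)].
Proof.
move=> nA nB; have [w ew] := free_product_spanned x.
have [] // := @cyclic_reduction w x; first by rewrite ew; apply: gconjugate_refl.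
move=> [w' [w0' cx good]]; pose q m := nth p0 w' (m %% size w').
exists (size w', fun m => (q m).1, fun m => (q m).2); split=> //=.
- by move=> i; rewrite /q modnDl.
- by move=> i; apply: good; rewrite ltn_pmod.
move: cx; rewrite -{1}[w']take_size wev_gev // => cx.
by rewrite (eq_gev (s' := fun i => iA (nth p0 w' i).1)
  (t' := fun i => iB (nth p0 w' i).2)) // => i lti; rewrite /q modn_small.
Qed.

End FreeProduct.

(** * Finite quotients *)

Section FiniteHom.
Variables (A : agroup) (gT : finGroupType) (f : A -> gT).
Hypothesis fM : is_fhom f.

Lemma fhom1 : f gone = 1.
Proof. by apply: (mulgI (f gone)); rewrite -fM gmulg1 mulg1. Qed.

Lemma fhomV x : f (ginv x) = (f x)^-1.
Proof. by apply: (mulgI (f x)); rewrite -fM gmulgV mulgV fhom1. Qed.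

Lemma fhom_conj g x : f (gconj g x) = f x ^ f g.
Proof. by rewrite /gconj !fM fhomV. Qed.

Lemma fhom_gev s t m : f (gev s t m) = ev (f \o s) (f \o t) m.
Proof.
elim: m => [|m IH]; first exact: fhom1.
by rewrite /gev -/gev !fM IH mulgA.
Qed.

Lemma order_conjugate x y : gconjugate x y -> #[f x] = #[f y].
Proof. by move=> [g ->]; rewrite fhom_conj orderJ. Qed.

End FiniteHom.

Lemma fhom_pair (A : agroup) (gT hT : finGroupType) (f : A -> gT) (h : A -> hT) :
  is_fhom f -> is_fhom h -> is_fhom (fun x => (f x, h x)).
Proof. by move=> fM hM x y; rewrite fM hM. Qed.

Lemma order_pair (gT hT : finGroupType) (x : gT) (y : hT) m :
  (#[(x, y)] %| m) = (#[x] %| m) && (#[y] %| m).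
Proof.
have e : (x, y) ^+ m = (x ^+ m, y ^+ m).
  by elim: m => [|m IH] //; rewrite !expgS IH.
by rewrite !order_dvdn e.
Qed.

Lemma residually_finite_family (A : agroup) (I : finType) (x : I -> A) :
  residually_finite A -> exists (gT : finGroupType) (f : A -> gT),
    is_fhom f /\ forall i, x i <> gone -> f (x i) <> 1.
Proof.
move=> rfA.
have [gT [f [fM H]]] : exists (gT : finGroupType) (f : A -> gT),
    is_fhom f /\ forall i, i \in enum I -> x i <> gone -> f (x i) <> 1.
  elim: (enum I) => [|j s [gT [f [fM H]]]].
    by exists {perm 'I_1}, (fun _ => 1); split=> // y z; rewrite mulg1.
  have [xj|xj] := pselect (x j = gone).
    exists gT, f; split=> // i; rewrite inE => /orP[/eqP->|] //; exact: H.
  have [hT [h [hM hj]]] := rfA _ xj.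
  exists (gT * hT)%type, (fun y => (f y, h y)); split; first exact: fhom_pair.
  move=> i; rewrite inE => /orP[/eqP-> _ [_]|/H hi /hi ni [//]].
  exact: hj.
by exists gT, f; split=> // i; apply: H; rewrite mem_enum.
Qed.

(** Residual finiteness is applied to the letters [x i], to all [x i] times the inverse of [x j],
    and to all products of two letters, so a match seen in the quotient already holds in [A]. *)
Lemma residually_finite_letters (A : agroup) (I : finType) (x : I -> A) :
  residually_finite A -> (forall i, x i <> gone) ->
  exists (gT : finGroupType) (f : A -> gT), [/\ is_fhom f,
    forall i, f (x i) != 1, forall i j, f (x i) = f (x j) -> x i = x j &
    forall i j, f (x i) * f (x j) = 1 -> gmul (x i) (x j) = gone].
Proof.
move=> rfA x1; pose y (i : I + (I * I + I * I)) := match i with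
  | inl i => x i
  | inr (inl p) => gmul (x p.1) (ginv (x p.2))
  | inr (inr p) => gmul (x p.1) (x p.2) end.
have [gT [f [fM H]]] := residually_finite_family y rfA.
exists gT, f; split=> //.
- by move=> i; apply/eqP; apply: (H (inl i)); apply: x1.
- move=> i j e; have [z|] := pselect (y (inr (inl (i, j))) = gone).
    by rewrite -[LHS]ginvK (ginv_eq z) ginvK.
  by move/H; rewrite /= fM fhomV // e mulgV.
move=> i j e; have [//|] := pselect (y (inr (inr (i, j))) = gone).
by move/H; rewrite /= fM e.
Qed.

Definition agroup_of (gT : finGroupType) : agroup :=
  @AGroup gT mulg 1 invg (@mulgA gT) (@mul1g gT) (@mulVg gT).

Lemma free_product_fhom (A B G : agroup) (iA : A -> G) (iB : B -> G)
  (R : finGroupType) (f : A -> R) (h : B -> R) :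
  is_free_product iA iB -> is_fhom f -> is_fhom h ->
  exists phi : G -> R, [/\ is_fhom phi, forall a, phi (iA a) = f a &
    forall b, phi (iB b) = h b].
Proof.
move=> [_ [_ U]] fM hM.
have [phi [[pM [pA pB]] _]] := U (agroup_of R) f h fM hM.
by exists phi.
Qed.

Lemma fhom_onto_image (G : agroup) (gT : finGroupType) (phi : G -> gT) :
  is_fhom phi -> exists (hT : finGroupType) (psi : G -> hT),
   [/\ is_fhom psi, forall y, exists x, psi x = y & forall x, #[psi x] = #[phi x]].
Proof.
move=> pM; pose H := [set y | `[< exists x, phi x = y >]].
have inH x : phi x \in H by rewrite inE; apply/asboolP; exists x.
have gH : group_set H.
  apply/group_setP; split; first by rewrite -(fhom1 pM) inH.
  move=> y z; rewrite !inE => /asboolP[a <-] /asboolP[b <-].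
  by apply/asboolP; exists (gmul a b); rewrite pM.
pose K := Group gH.
exists (subg_of K), (fun x => subg K (phi x)); split.
- by move=> x y; rewrite pM (morphM (subg_morphism K)) ?inH.
- move=> y; have := subgP y; rewrite inE => /asboolP[x e].
  by exists x; rewrite e sgvalK.
- by move=> x; rewrite -[RHS](order_injm (injm_subg K)) ?inH.
Qed.

(* Assembly of the quotients for the single words *)
Close Scope group_scope.

Theorem mainTheorem1 (A B G : agroup) (iA : A -> G) (iB : B -> G)
  (hfp : is_free_product iA iB)
  (hA : residually_finite A) (hB : residually_finite B)
  (n : nat) (u : 'I_n -> G)
  (h1 : forall i, ~ (exists (g : G) (a : A), u i = gconj g (iA a))
               /\ ~ (exists (g : G) (b : B), u i = gconj g (iB b)))
  (h2 : forall i j, i != j ->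
          ~ (exists c g : G, in_cyclic c (u i) /\ in_cyclic (gconj g c) (u j))) :
  exists K : nat, forall l : 'I_n -> nat, (forall i, 0 < l i) ->
    exists (gT : finGroupType) (phi : G -> gT),
      is_fhom phi /\ (forall y : gT, exists x : G, phi x = y) /\
      (forall i, #[phi (u i)]%g = K * l i).
Proof.
have form i : exists z : nat * (nat -> A) * (nat -> B),
   [/\ 0 < z.1.1, forall m, z.1.2 (z.1.1 + m) = z.1.2 m /\ z.2 (z.1.1 + m) = z.2 m,
    forall m, z.1.2 m <> gone /\ z.2 m <> gone &
    gconjugate (u i) (gev (fun m => iA (z.1.2 m)) (fun m => iB (z.2 m)) z.1.1)].
  apply: cyclic_form => // -[c [g e]].
    by apply: (proj1 (h1 i)); exists g, c.
  by apply: (proj2 (h1 i)); exists g, c.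
have [z Hz] := choice form.
pose k i := (z i).1.1; pose a i := (z i).1.2; pose b i := (z i).2.
have k0 i : 0 < k i by case: (Hz i).
have pa i m : a i (k i + m) = a i m by case: (Hz i) => _ /(_ m)[].
have pb i m : b i (k i + m) = b i m by case: (Hz i) => _ /(_ m)[].
have a1 i m : a i m <> gone by case: (Hz i) => _ _ /(_ m)[].
have b1 i m : b i m <> gone by case: (Hz i) => _ _ /(_ m)[].
have cu i : gconjugate (u i) (gev (fun m => iA (a i m)) (fun m => iB (b i m)) (k i)).
  by case: (Hz i).
clearbody k a b; clear z Hz form.
(* A common period of all words, so only the finitely many letters indexed by ['I_n * 'I_K]
   occur. *)
pose K := \prod_i k i.
have K0 : 0 < K by apply: prodn_gt0.
have kK i : k i %| K by rewrite /K (bigD1 i) //= dvdn_mulr.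
have ltK m : m %% K < K by rewrite ltn_pmod.
have perK C (y : 'I_n -> nat -> C) : (forall i m, y i (k i + m) = y i m) ->
    forall i m, y i m = y i (m %% K).
  move=> py i m; apply: (period_mod (py i)).
  by rewrite modn_dvdm.
have [A0 [fA [fAM fA1 fAinj fAV]]] := residually_finite_letters
  (x := fun p : 'I_n * 'I_K => a p.1 p.2) hA (fun p => a1 _ _).
have [B0 [fB [fBM fB1 fBinj fBV]]] := residually_finite_letters
  (x := fun p : 'I_n * 'I_K => b p.1 p.2) hB (fun p => b1 _ _).
pose o m := Ordinal (ltK m).
have ao i m : a i m = a i (o m) by apply: perK pa _ _.
have bo i m : b i m = b i (o m) by apply: perK pb _ _.
have indep i : exists M : nat, forall l : nat, 0 < l ->
    exists (R : finGroupType) (phi : G -> R), [/\ is_fhom phi,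
      #[phi (u i)]%g = (M * l)%N & forall j, j != i -> #[phi (u j)]%g %| M].
  have [||||||||M HM] := @finite_independence A0 B0 'I_n K
    (fun i m => fA (a i m)) (fun i m => fB (b i m)) k i K0.
  - by move=> j m; rewrite ao; apply: (fA1 (j, o m)).
  - by move=> j m; rewrite bo; apply: (fB1 (j, o m)).
  - exact: k0.
  - exact: kK.
  - by move=> j m; rewrite pa.
  - by move=> j m; rewrite pb.
  (* A match in [A0] and [B0] lifts to the letters in [A] and [B], and would put [u i] and [u j]
     into conjugate cyclic subgroups. *)
  - move=> j ji [N H]; apply: (h2 i j); first by rewrite eq_sym.
    apply: (match_dir (k0 j) (pa i) (pb i) (pa j) (pb j) (cu i) (cu j)
      (N := N)) => m.
    have [] := H m; rewrite ao bo [a i _]ao [b i _]bo.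
    by move=> /(fAinj (j, o m) (i, o (N + m))) ? /(fBinj (j, o m) (i, o (N + m))).
  - move=> j ji [N H]; apply: (h2 i j); first by rewrite eq_sym.
    have [iAM [iBM _]] := hfp.
    apply: (match_rev iAM iBM (k0 j) (pa i) (pb i) (pa j) (pb j) (cu i) (cu j)
      K0 (N := N)) => m y.
    have [HA HB] := H m y; split=> e.
      by have := HA e; rewrite ao [a i _]ao => /(fAV (j, o m) (i, o y)).
    by have := HB e; rewrite bo [b i _]bo => /(fBV (j, o m) (i, o y)).
  exists M => l l0; have [R [F [H [FM HM' oi oj]]]] := HM l l0.
  have [phi [pM pA pB]] := @free_product_fhom _ _ _ iA iB R (F \o fA) (H \o fB) hfp
    (fun x y => etrans (congr1 F (fAM x y)) (FM _ _))
    (fun x y => etrans (congr1 H (fBM x y)) (HM' _ _)).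
  have oe j : #[phi (u j)]%g =
      #[ev (fun m => F (fA (a j m))) (fun m => H (fB (b j m))) (k j)]%g.
    rewrite (order_conjugate pM (cu j)) (fhom_gev pM).
    by congr #[_]%g; apply: eq_ev => m /=; rewrite ?pA ?pB.
  by exists R, phi; split=> // [|j ji]; rewrite oe ?oi ?oj.
have [M HM] := choice indep.
have M0 i : 0 < M i.
  have [R [phi [_ e _]]] := HM i 1%N (ltn0Sn 0).
  by have := order_gt0 (phi (u i)); rewrite e muln1.
pose P := \prod_i M i.
have MP i : M i %| P by rewrite /P (bigD1 i) //= dvdn_mulr.
exists P => l l0.
(* Along [s] the quotients are multiplied together: every order keeps dividing its target [P * l j],
   and the target is attained for the indices already treated. *)
have comb (s : seq 'I_n) : exists (R : finGroupType) (phi : G -> R),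
    is_fhom phi /\ forall j, #[phi (u j)]%g %| P * l j /\
      (j \in s -> P * l j %| #[phi (u j)]%g).
  elim: s => [|i s [R [phi [pM H]]]].
    exists {perm 'I_1}, (fun _ => 1%g); split; first by move=> x y; rewrite mulg1.
    by move=> j; rewrite order1 dvd1n.
  (* This multiplier gives [u i] the order [P * l i], while the other orders divide [M i] and hence
     [P]. *)
  have l'0 : 0 < P %/ M i * l i.
    by rewrite muln_gt0 l0 divn_gt0 // dvdn_leq // prodn_gt0.
  have [R' [phi' [pM' oi oj]]] := HM i _ l'0.
  have {}oi : #[phi' (u i)]%g = (P * l i)%N by rewrite oi mulnA [(M i * _)%N]mulnC divnK.
  exists (R * R')%type, (fun x => (phi x, phi' x)); split; first exact: fhom_pair.
  move=> j; have [Hj1 Hj2] := H j; split.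
    rewrite order_pair Hj1 /=; have [->|ji] := eqVneq j i; first by rewrite oi.
    by apply: dvdn_trans (oj _ ji) _; rewrite dvdn_mulr.
  have := dvdnn #[(phi (u j), phi' (u j))]%g; rewrite order_pair => /andP[d1 d2].
  rewrite inE => /orP[/eqP e|js]; first by move: d2; rewrite e oi.
  exact: dvdn_trans (Hj2 js) d1.
have [R [phi [pM H]]] := comb (enum 'I_n).
have [gT [psi [sM onto oe]]] := fhom_onto_image pM.
exists gT, psi; split=> //; split=> // i; have [d1 d2] := H i.
by apply/eqP; rewrite oe eqn_dvd d1 d2 ?mem_enum.
Qed.
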